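(* Let $M$ be a smooth compact surface with $\chi(M)<0$, $h$ a smooth Riemannian metric on $M$ of constant Gauss curvature $-1$, and $g_0=e^{2\bar p_0}h$ a smooth metric with $\mathrm{area}(M,g_0)=\mathrm{area}(M,h)$. Then the solution $\bar p_t$ of the normalized Ricci flow $$\partial_t\bar p_t=e^{-2\bar p_t}(\Delta_h\bar p_t+1)-1$$ with initial condition $\bar p_0$ converges to $0$ in the $C^0$-norm (i.e. uniformly on $M$) exponentially fast as $t\to\infty$.
   Context: $M$ has no boundary; $\Delta_h$ is the Laplacian of $h$. The displayed equation is the normalized Ricci flow for $g_t=e^{2\bar p_t}h$; a smooth solution is known to exist for all $t\ge0$. ''Exponentially fast'' means $\sup_{x\in M}|\bar p_t(x)|\le ce^{-Ct}$ for all $t\ge0$ with constants $c,C>0$ independent of $t$. *)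

(* Defs.v *)
From HB Require Import structures.
From mathcomp Require Export all_boot all_order all_algebra.
From mathcomp Require Export all_classical all_reals all_analysis.
Export numFieldNormedType.Exports.

(* MathComp-Analysis; surfaces are modelled on the space 'rV[R]_2 of row
   vectors, R : realType. *)

Set Implicit Arguments.
Unset Strict Implicit.
Unset Printing Implicit Defensive.

Import Order.TTheory GRing.Theory Num.Theory.
Local Open Scope classical_set_scope.
Local Open Scope ring_scope.

Section SmoothFunctions.
Variables (R : realType) (n : nat).
Implicit Types (f : 'rV[R]_n -> R) (U A : set 'rV[R]_n).

Definition partial (i : 'I_n) f : 'rV[R]_n -> R :=
  fun u => 'D_(delta_mx 0 i) f u.

Definition iter_partial (s : seq 'I_n) f : 'rV[R]_n -> R := foldr partial f s.

(* C^infinity on U, meant for U open. *)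
Definition smooth_on U f : Prop :=
  forall (s : seq 'I_n) (u : 'rV[R]_n), U u -> differentiable (iter_partial s f) u.

(* C^infinity on an arbitrary subset A (e.g. a half-space): f agrees near each
   point of A with a smooth function defined on an open set. *)
Definition smooth_within A f : Prop :=
  forall a, A a -> exists (U : set 'rV[R]_n) (F : 'rV[R]_n -> R),
    [/\ open U, U a, smooth_on U F & forall u, U u -> A u -> F u = f u].

End SmoothFunctions.

(* The values of chart_map outside chart_dom and of chart_inv outside
   chart_map @` chart_dom are irrelevant. *)
Record chart (R : realType) (T : topologicalType) := Chart {
  chart_dom : set T;
  chart_map : T -> 'rV[R]_2;
  chart_inv : 'rV[R]_2 -> T;
  chart_dom_open : open chart_dom;
  chart_img_open : open (chart_map @` chart_dom);
  chart_mapK : forall x, chart_dom x -> chart_inv (chart_map x) = x;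
  chart_map_continuous : {within chart_dom, continuous chart_map};
  chart_inv_continuous : {within chart_map @` chart_dom, continuous chart_inv}
}.

Definition chart_img (R : realType) (T : topologicalType) (c : chart R T) :
  set 'rV[R]_2 := chart_map c @` chart_dom c.

Definition transition (R : realType) (T : topologicalType) (c d : chart R T) :
  'rV[R]_2 -> 'rV[R]_2 := fun u => chart_map d (chart_inv c u).

Definition overlap (R : realType) (T : topologicalType) (c d : chart R T) :
  set 'rV[R]_2 := [set u | chart_img c u /\ chart_dom d (chart_inv c u)].

(* A smooth surface without boundary: the charts take values in open subsets of
   the plane. The structure is given by an atlas indexed by atlas_index, with a
   preferred chart chart_at x around each point x. *)
Record surface (R : realType) := Surface {
  carrier :> topologicalType;
  carrier_hausdorff : hausdorff_space carrier;
  carrier_second_countable : @second_countable carrier;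
  atlas_index : Type;
  atlas : atlas_index -> chart R carrier;
  chart_at : carrier -> atlas_index;
  chart_atP : forall x, chart_dom (atlas (chart_at x)) x;
  transition_smooth : forall (c d : atlas_index) (j : 'I_2),
    smooth_on (overlap (atlas c) (atlas d))
      (fun u => transition (atlas c) (atlas d) u 0 j)
}.

(* A smooth Riemannian metric, as its matrices (g_ij) in the charts, functions
   of the coordinates. 'J acts on row vectors, i.e. ('J phi u) i j is the
   derivative of phi_j in the i-th direction. *)
Record metric (R : realType) (M : surface R) := Metric {
  gmat :> atlas_index M -> 'rV[R]_2 -> 'M[R]_2;
  gmat_smooth : forall (c : atlas_index M) (i j : 'I_2),
    smooth_on (chart_img (atlas c)) (fun u => gmat c u i j);
  gmat_sym : forall (c : atlas_index M) u,
    chart_img (atlas c) u -> (gmat c u)^T = gmat c u;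
  gmat_posdef : forall (c : atlas_index M) u, chart_img (atlas c) u ->
    forall v : 'rV[R]_2, v != 0 -> 0 < (v *m gmat c u *m v^T) 0 0;
  gmat_transition : forall (c d : atlas_index M) u,
    overlap (atlas c) (atlas d) u ->
    let phi := transition (atlas c) (atlas d) in
    gmat c u = 'J phi u *m gmat d (phi u) *m ('J phi u)^T
}.

(* g = e^{2q} h *)
Definition conformal_to (R : realType) (M : surface R) (g h : metric M)
    (q : M -> R) : Prop :=
  forall (c : atlas_index M) (u : 'rV[R]_2), chart_img (atlas c) u ->
    g c u = expR (2 * q (chart_inv (atlas c) u)) *: h c u.

Section LocalGeometry.
Variables (R : realType) (G : 'rV[R]_2 -> 'M[R]_2).

(* christoffel k i j = Gamma^k_ij *)
Definition christoffel (k i j : 'I_2) : 'rV[R]_2 -> R := fun u =>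
  2^-1 * \sum_l invmx (G u) k l *
    (partial i (fun v => G v j l) u + partial j (fun v => G v i l) u
     - partial l (fun v => G v i j) u).

(* R(d_i, d_j) d_k = sum_l (riemann l i j k) d_l, for
   R(X, Y) = [nabla_X, nabla_Y] - nabla_[X,Y]. *)
Definition riemann (l i j k : 'I_2) : 'rV[R]_2 -> R := fun u =>
  partial i (christoffel l j k) u - partial j (christoffel l i k) u
  + \sum_m (christoffel m j k u * christoffel l i m u
            - christoffel m i k u * christoffel l j m u).

(* g(R(d_0, d_1) d_1, d_0) / det g *)
Definition local_gauss_curvature : 'rV[R]_2 -> R := fun u =>
  (\sum_l G u l 0 * riemann l 0 1 1 u) / \det (G u).

(* The trace of the covariant Hessian (a nonpositive operator). *)
Definition local_laplacian (f : 'rV[R]_2 -> R) : 'rV[R]_2 -> R := fun u =>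
  \sum_i \sum_j invmx (G u) i j *
    (partial i (partial j f) u - \sum_k christoffel k i j u * partial k f u).

End LocalGeometry.

(* Both notions are invariant under changes of charts, so the preferred chart
   around x may be used. *)
Definition gauss_curvature (R : realType) (M : surface R) (g : metric M)
    (x : M) : R :=
  local_gauss_curvature (g (chart_at x)) (chart_map (atlas (chart_at x)) x).

Definition laplacian (R : realType) (M : surface R) (g : metric M)
    (f : M -> R) (x : M) : R :=
  local_laplacian (g (chart_at x))
    (fun u => f (chart_inv (atlas (chart_at x)) u))
    (chart_map (atlas (chart_at x)) x).

Definition vec2 (R : realType) (z : R * R) : 'rV[R]_2 :=
  \row_j (if j == 0 then z.1 else z.2).

(* The coordinates of the points of A in the chart c, as a subset of R * R,
   which unlike 'rV[R]_2 carries Lebesgue measure. *)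
Definition coords (R : realType) (M : surface R) (c : atlas_index M)
    (A : set M) : set (measurableTypeR R * measurableTypeR R) :=
  [set z | (chart_map (atlas c) @` A) (vec2 z)].

Definition piece_area (R : realType) (M : surface R) (g : metric M)
    (c : atlas_index M) (A : set M) : \bar R :=
  (\int[lebesgue_measure \x lebesgue_measure]_(z in coords c A)
     (Num.sqrt (\det (g c (vec2 z))))%:E)%E.

(* The total Riemannian area, as the supremum of the areas of finite disjoint
   families of Borel pieces, each lying in a chart. On a compact surface it is
   attained, by any finite partition of the surface into such pieces. *)
Definition area (R : realType) (M : surface R) (g : metric M) : \bar R :=
  ereal_sup [set a | exists (n : nat) (c : 'I_n -> atlas_index M)
      (A : 'I_n -> set M),
    [/\ forall i, A i `<=` chart_dom (atlas (c i)),
        forall i, measurable (coords (c i) (A i)),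
        trivIset setT A
      & a = (\sum_(i < n) piece_area g (c i) (A i))%E]].

(* Abstract simplicial complexes on the vertices 'I_n, given by their nonempty
   faces. *)
Definition simplicial_complex (n : nat) (K : {set {set 'I_n}}) : Prop :=
  finset.set0 \notin K /\
  forall s t : {set 'I_n}, s \in K -> t \subset s -> t != finset.set0 -> t \in K.

(* Points given by their barycentric coordinates. *)
Definition realization (R : realType) (n : nat) (K : {set {set 'I_n}}) :
  set 'rV[R]_n :=
  [set a | [/\ forall i, 0 <= a 0 i, \sum_i a 0 i = 1
            & [set i | a 0 i != 0]%SET \in K]].

Definition simplicial_euler (n : nat) (K : {set {set 'I_n}}) : int :=
  \sum_(s in K) (-1) ^+ #|s|.-1.

(* chi is the Euler characteristic of T, computed from a triangulation of T
   (a homeomorphism, with inverse b, from a finite complex onto T); it does not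
   depend on the triangulation. *)
Definition has_euler_characteristic (R : realType) (T : topologicalType)
    (chi : int) : Prop :=
  exists (n : nat) (K : {set {set 'I_n}}) (f : 'rV[R]_n -> T)
      (b : T -> 'rV[R]_n),
    [/\ simplicial_complex K,
        {within realization K, continuous f} /\ continuous b,
        (forall a, realization K a -> b (f a) = a),
        (forall x, realization K (b x) /\ f (b x) = x)
      & chi = simplicial_euler K].

(* Smoothness of (t, x) |-> p t x on [0, +oo[ * M; a row vector w : 'rV_(1 + 2)
   stands for the time and the two coordinates. *)
Definition smooth_flow (R : realType) (M : surface R) (p : R -> M -> R) :
  Prop :=
  forall c : atlas_index M,
    smooth_within
      [set w : 'rV[R]_(1 + 2) |
        0 <= lsubmx w 0 0 /\ chart_img (atlas c) (rsubmx w)]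
      (fun w => p (lsubmx w 0 0) (chart_inv (atlas c) (rsubmx w))).

(* d/dt p_t = e^{-2 p_t} (Delta_h p_t + 1) - 1 for all t >= 0, the time
   derivative being taken in [0, +oo[, hence one-sided at t = 0. *)
Definition normalized_ricci_flow (R : realType) (M : surface R) (h : metric M)
    (p : R -> M -> R) : Prop :=
  forall (t : R) (x : M), 0 <= t ->
    s^-1 * (p (t + s) x - p t x)
      @[s --> within [set s : R | 0 <= t + s] (0 : R)^'] -->
    expR (- 2 * p t x) * (laplacian h (p t) x + 1) - 1.

(* Main.v *)
Require Import Defs.
From mathcomp Require Import ring lra.
Import Order.TTheory GRing.Theory Num.Theory.
Local Open Scope classical_set_scope.
Local Open Scope ring_scope.

Set Implicit Arguments.
Unset Strict Implicit.
Unset Printing Implicit Defensive.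

(** The proof is a maximum principle. Write q for the solution at time t and
    consider v = (e^{2q} - 1) e^{2t}. The flow gives
      d/dt e^{2q} = 2 (Delta q + 1 - e^{2q}),
    so in the derivative of v the zeroth order terms cancel and
      d/dt v = 2 e^{2t} Delta q                 (rescaled_defect_is_derive).
    At a fixed time, v is an increasing function of q; where v is maximal on
    the surface so is q, hence Delta q <= 0 there, and where v is minimal
    Delta q >= 0. The maximum principle (parabolic_max_principle), applied to v
    and to -v, then bounds v for all times by its extrema at time 0. If
    |q| <= P at time 0, this reads
      - (1 - e^{-2P}) e^{-2t} <= e^{2q} - 1 <= (e^{2P} - 1) e^{-2t},
    and 1 + x <= e^x turns it into |q| <= (e^{2P} - 1) / 2 * e^{-2t}
    (norm_le_of_defect). So the rate is 2: near the solution 0 the reaction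
    term e^{-2q} - 1 is -2q to first order.

    Two ingredients need work. The sign of the Laplacian at an extremum
    (local_laplacian_le0) comes from the second derivative test along straight
    lines in a chart: the gradient vanishes, which removes the Christoffel
    terms, and a positive definite matrix g^{ij} is a sum of squares of
    vectors, so g^{ij} d_i d_j q is a sum of second derivatives along lines.
    The other ingredient is the passage from the smoothness of the flow, given
    by local extensions of it in R x R^2, to the smoothness of each time slice
    (smooth_flow_slice) and to joint continuity on [0, +oo[ x M
    (smooth_flow_continuous), by which maxima over [0, tau] x M are attained. *)

(** * Smooth functions on open sets *)

Lemma smooth_on_partial (R : realType) (n : nat) (U : set 'rV[R]_n) f i :
  smooth_on U f -> smooth_on U (partial i f).
Proof.
move=> sf s u Uu; have := sf (rcons s i) u Uu.
by rewrite /iter_partial foldr_rcons.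
Qed.

Lemma smooth_on_differentiable (R : realType) (n : nat) (U : set 'rV[R]_n) f u :
  smooth_on U f -> U u -> differentiable f u.
Proof. by move=> sf Uu; exact: (sf [::]). Qed.

Lemma eq_iter_partial (R : realType) (n : nat) (U : set 'rV[R]_n)
    (f g : 'rV[R]_n -> R) (s : seq 'I_n) :
  open U -> (forall u, U u -> f u = g u) ->
  forall u, U u -> iter_partial s f u = iter_partial s g u.
Proof.
move=> oU fg; elim: s => [|i s IH] u Uu /=; first exact: fg.
apply: near_eq_derive; near=> v; apply: IH.
by near: v; exact: open_nbhs_nbhs.
Unshelve. all: by end_near. Qed.

Lemma iter_partialN (R : realType) (n : nat) (U : set 'rV[R]_n)
    (f : 'rV[R]_n -> R) (s : seq 'I_n) :
  open U -> smooth_on U f ->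
  forall u, U u -> iter_partial s (- f) u = - iter_partial s f u.
Proof.
move=> oU sf; elim: s => [//|i s IH] u Uu /=.
rewrite /partial -deriveN; last exact/diff_derivable/sf.
apply: near_eq_derive; near=> v; apply: IH.
by near: v; exact: open_nbhs_nbhs.
Unshelve. all: by end_near. Qed.

(** The differential is chosen from the first order expansion, which only
    depends on the germ of the function. *)
Lemma near_eq_differentiable (R : realType) (V W : normedModType R)
    (f g : V -> W) (x : V) :
  (\near x, f x = g x) -> differentiable f x -> differentiable g x.
Proof.
move=> fg /diff_locallyP [dfc /eqaddoP fE].
have gE : g \o shift x = cst (g x) + 'd f x +o_ 0 id.
  have fg0 : \forall h \near 0, f (h + x) = g (h + x).
    by move: fg; rewrite (near_shift 0) subr0.
  apply/eqaddoP => e e0; near=> h.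
  have <- : (f \o shift x - (cst (f x) + 'd f x)) h =
            (g \o shift x - (cst (g x) + 'd f x)) h.
    rewrite !fctE /= (nbhs_singleton fg); congr (_ - _).
    by near: h.
  by near: h; exact: fE.
have dE : 'd g x = 'd f x :> (V -> W) by exact: diff_unique gE.
by apply/diff_locallyP; rewrite dE.
Unshelve. all: by end_near. Qed.

Lemma eq_smooth_on (R : realType) (n : nat) (U : set 'rV[R]_n)
    (f g : 'rV[R]_n -> R) :
  open U -> (forall u, U u -> f u = g u) -> smooth_on U f -> smooth_on U g.
Proof.
move=> oU fg sf s u Uu; apply: near_eq_differentiable (sf s u Uu).
near=> v; apply: (eq_iter_partial s oU fg).
by near: v; exact: open_nbhs_nbhs.
Unshelve. all: by end_near. Qed.

Lemma smooth_onN (R : realType) (n : nat) (U : set 'rV[R]_n)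
    (f : 'rV[R]_n -> R) :
  open U -> smooth_on U f -> smooth_on U (- f).
Proof.
move=> oU sf s u Uu.
apply: (@near_eq_differentiable _ _ _ (- iter_partial s f)).
  near=> v; rewrite (iter_partialN s oU sf)//.
  by near: v; exact: open_nbhs_nbhs.
exact/differentiableN/sf.
Unshelve. all: by end_near. Qed.

(** * The second derivative test *)

Lemma is_derive_line (R : realType) (n : nat) (f : 'rV[R]_n -> R)
    (b u : 'rV[R]_n) (s : R) :
  derivable f (s *: b + u) b ->
  is_derive s (1 : R) (fun r : R => f (r *: b + u)) ('D_b f (s *: b + u)).
Proof.
move=> df.
have E : (fun h : R => h^-1 *: (((fun r => f (r *: b + u)) \o shift s) (h *: 1)
            - f (s *: b + u)))
       = (fun h => h^-1 *: ((f \o shift (s *: b + u)) (h *: b) - f (s *: b + u))).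
  by apply/funext => h /=; rewrite scaler1 scalerDl addrA.
by apply: DeriveDef; rewrite /derivable /derive E.
Qed.

Lemma derive_partials (R : realType) (n : nat) (f : 'rV[R]_n -> R)
    (b u : 'rV[R]_n) :
  differentiable f u -> 'D_b f u = \sum_i b 0 i * partial i f u.
Proof.
move=> df; rewrite deriveE// {1}(row_sum_delta b) linear_sum.
by apply: eq_bigr => i _; rewrite linearZ /partial deriveE.
Qed.

(** If d2 were positive, dg would be positive on some ]0, e[ since dg 0 = 0,
    and by the mean value theorem g would exceed g 0 there. *)
Lemma second_derivative_test (R : realType) (g dg : R -> R) (d2 : R) :
  (\forall s \near (0 : R), is_derive s (1 : R) g (dg s)) ->
  is_derive (0 : R) (1 : R) dg d2 ->
  (\forall s \near (0 : R), g s <= g 0) ->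
  dg 0 = 0 /\ d2 <= 0.
Proof.
move=> g1 dg1 gmax.
have [e /= e0 He] : \forall s \near (0 : R), is_derive s (1 : R) g (dg s) /\ g s <= g 0.
  by near=> s; split; near: s.
have {}He s : `|s| < e -> is_derive s (1 : R) g (dg s) /\ g s <= g 0.
  by move=> se; apply: He; rewrite /ball_ /= sub0r normrN.
have dg0 : dg 0 = 0.
  have [dv0 _] := He 0 ltac:(by rewrite normr0).
  have m0 : is_derive (0 : R) (1 : R) g 0.
    apply: (@derive1_at_max R g (- e) e 0).
    - by rewrite -subr_ge0; lra.
    - move=> t; rewrite in_itv /= => /andP[t1 t2].
      have [] := He t; first by rewrite ltr_norml t1 t2.
      by [].
    - by rewrite in_itv /=; apply/andP; split; lra.
    - move=> t; rewrite in_itv /= => /andP[t1 t2].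
      by have [] := He t; first by rewrite ltr_norml t1 t2.
  by rewrite -(derive_val (is_derive := dv0)) (derive_val (is_derive := m0)).
split => //; rewrite leNgt; apply/negP => d2pos.
have [dgd dgv] := dg1.
have : (fun h : R => h^-1 *: ((dg \o shift 0) (h *: 1) - dg 0)) @ 0^' --> d2.
  by rewrite -dgv.
move=> /cvgr_gt /(_ _ d2pos) [e1 /= e10 He1].
pose h := Num.min e e1 / 2.
have mpos : 0 < Num.min e e1 by rewrite lt_min e0.
have hpos : 0 < h by rewrite /h divr_gt0.
have [hlte hlte1] : h < e /\ h < e1.
  have : h < Num.min e e1 by rewrite /h; lra.
  by rewrite lt_min => /andP[].
have dgpos c : 0 < c -> c < e1 -> 0 < dg c.
  move=> c0 ce; have /= := He1 c; rewrite dg0 subr0 addr0 scaler1.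
  rewrite /ball_ /= sub0r normrN gtr0_norm// => /(_ ce (lt0r_neq0 c0)).
  by rewrite /GRing.scale /= pmulr_rgt0 // invr_gt0.
have [||c] := @MVT R g dg 0 h hpos.
- move=> x; rewrite in_itv /= => /andP[x0 xh].
  by have [] := He x; first by rewrite gtr0_norm//; lra.
- apply: derivable_within_continuous => x; rewrite in_itv /= => /andP[x0 xh].
  by have [] := He x; first by rewrite ger0_norm//; lra.
rewrite in_itv /= => /andP[c0 ch] E.
have := dgpos c c0 (lt_trans ch hlte1).
have [_ ] := He h ltac:(by rewrite gtr0_norm).
move: E; rewrite subr0 => E gh dc.
have : 0 < dg c * h by rewrite mulr_gt0.
by rewrite -E; lra.
Unshelve. all: by end_near. Qed.

(** The second derivative test on the line u + s b, on which the derivatives of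
    f are 'D_b f and 'D_b ('D_b f). The quadratic form is expanded in partial
    derivatives in the order in which the Laplacian composes them. *)
Lemma second_derivative_at_max (R : realType) (n : nat) (U : set 'rV[R]_n)
    (f : 'rV[R]_n -> R) (u b : 'rV[R]_n) :
  open U -> smooth_on U f -> U u -> (\forall v \near u, f v <= f u) ->
  'D_b f u = 0 /\
  \sum_i \sum_j b 0 i * b 0 j * partial i (partial j f) u <= 0.
Proof.
move=> oU sf Uu fmax.
have line : (fun s : R => s *: b + u) @ 0 --> u.
  have : (fun s : R => s *: b + u) @ 0 --> 0 *: b + u.
    by apply: cvgD; [apply: cvgZr_tmp; exact: cvg_id | exact: cvg_cst].
  by rewrite scale0r add0r.
have nU : \forall v \near u, U v by exact: open_nbhs_nbhs.
have diff i : differentiable (partial i f) u.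
  exact: smooth_on_differentiable (smooth_on_partial _ sf) Uu.
have Db2 : is_derive u b ('D_b f)
    (\sum_j b 0 j *: 'D_b (partial j f) u).
  apply: (@near_eq_is_derive _ _ _ (\sum_j b 0 j \*: partial j f)).
    near=> v; rewrite (derive_partials _ (smooth_on_differentiable sf _)).
      by rewrite fct_sumE.
    by near: v.
  apply: is_derive_sum => j; apply: is_deriveZ.
  exact/derivableP/diff_derivable.
have D0 : ('D_b f (0 *: b + u) = 'D_b f u) by rewrite scale0r add0r.
have [|||E1 E2] := @second_derivative_test R (fun s => f (s *: b + u))
  (fun s => 'D_b f (s *: b + u)) (\sum_j b 0 j *: 'D_b (partial j f) u).
- near=> s; have Us : U (s *: b + u) by near: s; exact: line nU.
  apply: is_derive_line.
  exact/diff_derivable/(smooth_on_differentiable sf Us).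
- have [d1 d2] := Db2.
  have := @is_derive_line R n ('D_b f) b u 0; rewrite scale0r add0r d2.
  exact.
- near=> s; rewrite scale0r add0r.
  by near: s; exact: line fmax.
split; first by rewrite -D0.
rewrite exchange_big /=; apply: le_trans E2; rewrite le_eqVlt; apply/orP; left.
apply/eqP; apply: eq_bigr => j _; rewrite derive_partials// scaler_sumr.
by apply: eq_bigr => i _; rewrite /GRing.scale /= mulrCA mulrA.
Unshelve. all: by end_near. Qed.

(** * The Laplacian at an extremum *)

Lemma sum_ord2 (V : nmodType) (F : 'I_2 -> V) : \sum_i F i = F 0 + F 1.
Proof.
rewrite big_ord_recl big_ord1; congr (F _ + F _); exact/val_inj.
Qed.

Lemma posdef_unitmx (R : realType) (n : nat) (G : 'M[R]_n) :
  (forall v : 'rV[R]_n, v != 0 -> 0 < (v *m G *m v^T) 0 0) -> G \in unitmx.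
Proof.
move=> Gpos; rewrite -row_free_unit -kermx_eq0.
apply/eqP/row_matrixP => i; rewrite row0; apply/eqP/negPn/negP => /Gpos.
by rewrite -row_mul mulmx_ker row0 mul0mx mxE ltxx.
Qed.

(** v G^{-1} v^T is the value of the form G at v G^{-1}. *)
Lemma posdef_invmx (R : realType) (n : nat) (G : 'M[R]_n) :
  G^T = G ->
  (forall v : 'rV[R]_n, v != 0 -> 0 < (v *m G *m v^T) 0 0) ->
  forall v : 'rV[R]_n, v != 0 -> 0 < (v *m invmx G *m v^T) 0 0.
Proof.
move=> Gsym Gpos v v0; have Gu := posdef_unitmx Gpos.
have := Gpos (v *m invmx G); rewrite trmx_mul trmx_inv Gsym mulmxKV//.
rewrite mulmxA; apply; apply: contra_neq v0 => vG.
by rewrite -(mulmxKV Gu v) vG mul0mx.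
Qed.

(** With a = P 0 0 and b = P 0 1, completing the square writes P as
    a (1, b/a)^T (1, b/a) + (P 1 1 - b^2/a) (0, 1)^T (0, 1), with positive
    coefficients; so the contraction is a positive combination of two values
    of the quadratic form of H. *)
Lemma posdef_contract_le0 (R : realType) (P : 'M[R]_2) (H : 'I_2 -> 'I_2 -> R) :
  P^T = P ->
  (forall v : 'rV[R]_2, v != 0 -> 0 < (v *m P *m v^T) 0 0) ->
  (forall b : 'rV[R]_2, \sum_i \sum_j b 0 i * b 0 j * H i j <= 0) ->
  \sum_i \sum_j P i j * H i j <= 0.
Proof.
move=> Psym Ppos Hneg.
have P10 : P 1 0 = P 0 1 by rewrite -{1}Psym mxE.
pose vec (x y : R) : 'rV[R]_2 := \row_j (if j == 0 then x else y).
have quad x y : (vec x y *m P *m (vec x y)^T) 0 0 =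
    x * x * P 0 0 + 2 * (x * y) * P 0 1 + y * y * P 1 1.
  rewrite !mxE sum_ord2 !mxE !sum_ord2 !mxE /=.
  by rewrite P10; ring.
have vec_neq0 x y : (x != 0) || (y != 0) -> vec x y != 0.
  move=> xy; apply/negP => /eqP /rowP E; move: xy.
  by have := E 0; have := E 1; rewrite !mxE /= => -> ->; rewrite eqxx.
have hess x y : x * x * H 0 0 + x * y * H 0 1 + x * y * H 1 0 + y * y * H 1 1 <= 0.
  have := Hneg (vec x y); rewrite !sum_ord2 !mxE /=.
  by rewrite (mulrC y x) !addrA.
rewrite !sum_ord2 P10.
have a0 : 0 < P 0 0.
  have := Ppos (vec 1 0); rewrite quad vec_neq0 ?oner_eq0//.
  by rewrite !mul0r !mul1r !mulr0 !mul0r !addr0; exact.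
set a := P 0 0 in a0 quad *; set b := P 0 1 in quad *; set c := P 1 1 in quad *.
have d0 : 0 < c - b * b / a.
  (* (- b/a, 1) minimizes the form P on the line y = 1. *)
  have := Ppos (vec (- (b / a)) 1); rewrite quad vec_neq0 ?oner_eq0 ?orbT//.
  rewrite (_ : _ + _ = c - b * b / a); first exact.
  by field; rewrite gt_eqF.
rewrite (_ : _ + _ = a * (1 * 1 * H 0 0 + 1 * (b / a) * H 0 1 + 1 * (b / a) * H 1 0
    + (b / a) * (b / a) * H 1 1)
  + (c - b * b / a) * (0 * 0 * H 0 0 + 0 * 1 * H 0 1 + 0 * 1 * H 1 0
    + 1 * 1 * H 1 1)); last by field; rewrite gt_eqF.
by rewrite -[leRHS]addr0; apply: lerD; rewrite pmulr_rle0//; exact: hess.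
Qed.

Lemma local_laplacian_le0 (R : realType) (G : 'rV[R]_2 -> 'M[R]_2)
    (U : set 'rV[R]_2) (f : 'rV[R]_2 -> R) (u : 'rV[R]_2) :
  (G u)^T = G u ->
  (forall v : 'rV[R]_2, v != 0 -> 0 < (v *m G u *m v^T) 0 0) ->
  open U -> smooth_on U f -> U u -> (\forall v \near u, f v <= f u) ->
  local_laplacian G f u <= 0.
Proof.
move=> Gsym Gpos oU sf Uu fmax.
have grad0 k : partial k f u = 0.
  by have [] := second_derivative_at_max (delta_mx 0 k) oU sf Uu fmax.
rewrite /local_laplacian.
under eq_bigr do under eq_bigr do
  (under eq_bigr do rewrite grad0 mulr0; rewrite big1// subr0).
apply: posdef_contract_le0.
- by rewrite trmx_inv Gsym.
- exact: posdef_invmx.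
- by move=> b; have [] := second_derivative_at_max b oU sf Uu fmax.
Qed.

Lemma local_laplacianN (R : realType) (G : 'rV[R]_2 -> 'M[R]_2)
    (U : set 'rV[R]_2) (f : 'rV[R]_2 -> R) (u : 'rV[R]_2) :
  open U -> smooth_on U f -> U u ->
  local_laplacian G (- f) u = - local_laplacian G f u.
Proof.
move=> oU sf Uu; rewrite /local_laplacian -sumrN.
apply: eq_bigr => i _; rewrite -sumrN; apply: eq_bigr => j _.
rewrite -mulrN opprB; congr (_ * _).
rewrite [partial i _ u](iter_partialN [:: i; j] oU sf Uu) addrC; congr (_ + _).
rewrite -sumrN; apply: eq_bigr => k _; rewrite -mulrN; congr (_ * _).
by rewrite [partial k _ u](iter_partialN [:: k] oU sf Uu) opprK.
Qed.

Lemma local_laplacian_ge0 (R : realType) (G : 'rV[R]_2 -> 'M[R]_2)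
    (U : set 'rV[R]_2) (f : 'rV[R]_2 -> R) (u : 'rV[R]_2) :
  (G u)^T = G u ->
  (forall v : 'rV[R]_2, v != 0 -> 0 < (v *m G u *m v^T) 0 0) ->
  open U -> smooth_on U f -> U u -> (\forall v \near u, f u <= f v) ->
  0 <= local_laplacian G f u.
Proof.
move=> Gsym Gpos oU sf Uu fmin.
rewrite -oppr_le0 -(local_laplacianN G oU sf Uu).
apply: (local_laplacian_le0 Gsym Gpos oU (smooth_onN oU sf) Uu).
by apply: filterS fmin => v; rewrite lerN2.
Qed.

Lemma laplacian_le0_at_max (R : realType) (M : surface R) (h : metric M)
    (f : M -> R) (x : M) :
  smooth_on (chart_img (atlas (chart_at x)))
    (fun u => f (chart_inv (atlas (chart_at x)) u)) ->
  (forall y, f y <= f x) -> laplacian h f x <= 0.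
Proof.
move=> sf fmax; have dx := chart_atP x.
have img : chart_img (atlas (chart_at x)) (chart_map (atlas (chart_at x)) x).
  by exists x.
apply: (local_laplacian_le0 (gmat_sym h img) (gmat_posdef h img) _ sf img).
  exact: chart_img_open.
by near=> v; rewrite chart_mapK.
Unshelve. all: by end_near. Qed.

Lemma laplacian_ge0_at_min (R : realType) (M : surface R) (h : metric M)
    (f : M -> R) (x : M) :
  smooth_on (chart_img (atlas (chart_at x)))
    (fun u => f (chart_inv (atlas (chart_at x)) u)) ->
  (forall y, f x <= f y) -> 0 <= laplacian h f x.
Proof.
move=> sf fmin; have dx := chart_atP x.
have img : chart_img (atlas (chart_at x)) (chart_map (atlas (chart_at x)) x).
  by exists x.
apply: (local_laplacian_ge0 (gmat_sym h img) (gmat_posdef h img) _ sf img).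
  exact: chart_img_open.
by near=> v; rewrite chart_mapK.
Unshelve. all: by end_near. Qed.

(** * Regularity of smooth flows *)

Section Slice.
Context {R : realType} {m n : nat}.

Lemma continuous_row_mx (a : 'rV[R]_m) :
  continuous (row_mx a : 'rV[R]_n -> 'rV[R]_(m + n)).
Proof.
move=> u A /nbhs_ballP[e /= e0 eA].
apply/nbhs_ballP; exists e => //= v [_ uv]; apply: eA; split => // i j.
case: (split_ordP j) => k ->; rewrite ?row_mxEl ?row_mxEr; last exact: uv.
exact: ballxx.
Qed.

(** The two difference quotients are the same function of the increment, so
    this is an equality of functions, which can be iterated. *)
Lemma partial_row_mx (a : 'rV[R]_m) (F : 'rV[R]_(m + n) -> R) (i : 'I_n) :
  partial i (F \o row_mx a) = partial (rshift m i) F \o row_mx a.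
Proof.
apply/funext => u.
have E (h : R) : row_mx a (h *: delta_mx 0 i + u)
    = h *: delta_mx 0 (rshift m i) + row_mx a u.
  apply/rowP => j; case: (split_ordP j) => k ->; rewrite [RHS]mxE.
    by rewrite !row_mxEl !mxE eq_lrshift andbF mulr0 add0r.
  by rewrite !row_mxEr !mxE (inj_eq (@rshift_inj _ _)).
rewrite /partial /derive /=.
suff -> : (fun h : R => h^-1 *: (((F \o row_mx a) \o shift u) (h *: delta_mx 0 i)
              - F (row_mx a u)))
        = (fun h => h^-1 *: ((F \o shift (row_mx a u))
              (h *: delta_mx 0 (rshift m i)) - F (row_mx a u))) by [].
by apply/funext => h /=; rewrite E.
Qed.

Lemma smooth_on_row_mx (a : 'rV[R]_m) (U : set 'rV[R]_(m + n))
    (F : 'rV[R]_(m + n) -> R) :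
  smooth_on U F -> smooth_on [set u | U (row_mx a u)] (F \o row_mx a).
Proof.
move=> sF s u Uu.
have -> : iter_partial s (F \o row_mx a)
        = iter_partial (map (@rshift m n) s) F \o row_mx a.
  by elim: s => //= i s ->; exact: partial_row_mx.
apply: differentiable_comp; last exact: sF.
have lin : row_mx 0 = mulmxr (row_mx 0 1%:M) :> ('rV[R]_n -> 'rV[R]_(m + n)).
  by apply/funext => v; rewrite /= mul_mx_row mulmx0 mulmx1.
have -> : row_mx a = cst (row_mx a 0) + row_mx 0 :> ('rV[R]_n -> _).
  by apply/funext => v; rewrite !fctE add_row_mx addr0 add0r.
apply: differentiableD => //.
rewrite lin; apply: linear_differentiable.
by have := @continuous_row_mx 0; rewrite lin.
Qed.

End Slice.

Lemma smooth_flow_slice (R : realType) (M : surface R) (p : R -> M -> R)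
    (t : R) (c : atlas_index M) :
  smooth_flow p -> 0 <= t ->
  smooth_on (chart_img (atlas c)) (fun u => p t (chart_inv (atlas c) u)).
Proof.
move=> sp t0 s u cu.
have [|U [F [oU Uu sF FE]]] := sp c (row_mx t%:M u).
  by rewrite /= row_mxKl row_mxKr mxE.
pose V := [set v | U (row_mx t%:M v)] `&` chart_img (atlas c).
have oV : open V.
  apply: openI; last exact: chart_img_open.
  exact: (open_comp (fun v _ => @continuous_row_mx R 1 2 _ v)).
have sV : smooth_on V (F \o row_mx t%:M).
  by move=> r v [Uv _]; exact: smooth_on_row_mx sF r v Uv.
apply: (eq_smooth_on oV _ sV) => [v [Uv cv]|]; last by [].
by rewrite /= FE//= row_mxKl row_mxKr mxE.
Qed.

(** Near (t, x) the flow is F (s, chart y), with F a smooth local extension of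
    its expression in the chart around x. *)
Lemma smooth_flow_continuous (R : realType) (M : surface R) (p : R -> M -> R) :
  smooth_flow p ->
  {within [set z : R * M | 0 <= z.1], continuous (fun z => p z.1 z.2)}.
Proof.
move=> sp; apply/subspace_continuousP => -[t x] /= t0.
have dx := chart_atP x; set c := atlas (chart_at x) in dx *.
have img : chart_img c (chart_map c x) by exists x.
have [|U [F [oU Uw sF FE]]] := sp (chart_at x) (row_mx t%:M (chart_map c x)).
  by rewrite /= row_mxKl row_mxKr mxE.
pose w (z : R * M) : 'rV[R]_(1 + 2) := row_mx z.1%:M (chart_map c z.2).
have near_dom : \forall z \near (t, x), chart_dom c z.2.
  have : \forall y \near x, chart_dom c y.
    by apply: open_nbhs_nbhs; split => //; exact: chart_dom_open.
  by move/(@cvg_snd _ _ (nbhs t) (nbhs x) _).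
have wcont : w @ (t, x) --> w (t, x).
  have cc : chart_map c @ x --> chart_map c x.
    have := @chart_map_continuous _ _ c.
    rewrite continuous_open_subspace; last exact: chart_dom_open.
    by apply; rewrite inE.
  move=> A /nbhs_ballP[e /= e0 eA].
  have n1 : \forall z \near (t, x), ball t e z.1.
    by apply: (@cvg_fst _ _ (nbhs t) (nbhs x) _); exact: nbhsx_ballx.
  have n2 : \forall z \near (t, x), ball (chart_map c x) e (chart_map c z.2).
    apply: (@cvg_snd _ _ (nbhs t) (nbhs x) _ [set y | ball (chart_map c x) e (chart_map c y)]).
    by apply: cc; exact: nbhsx_ballx.
  suff : \forall z \near (t, x), A (w z) by [].
  near=> z; apply: eA.
  have zt : ball t e z.1 by near: z.
  have [_ zx] : ball (chart_map c x) e (chart_map c z.2) by near: z.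
  split => // i j; case: (split_ordP j) => k ->; rewrite ?row_mxEl ?row_mxEr.
    by rewrite !mxE; case: eqP => _; [exact: zt | exact: ballxx].
  exact: zx.
have Fcont : F @ w (t, x) --> F (w (t, x)).
  exact/differentiable_continuous/(smooth_on_differentiable sF Uw).
have Fw : (F \o w) @ within [set z : R * M | 0 <= z.1] (nbhs (t, x)) --> p t x.
  have -> : p t x = F (w (t, x)).
    by rewrite /w FE //= ?row_mxKl ?row_mxKr !mxE ?chart_mapK.
  apply: cvg_within_filter; exact: (cvg_comp _ _ wcont Fcont).
apply: cvg_trans Fw; apply: near_eq_cvg.
have nU : \forall z \near (t, x), U (w z).
  by apply: wcont; exact: open_nbhs_nbhs.
suff : \forall z \near (t, x), 0 <= z.1 -> F (w z) = p z.1 z.2 by [].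
near=> z => z0; have dz : chart_dom c z.2 by near: z.
rewrite /= FE; last 2 first.
- by near: z.
- by rewrite /w /= row_mxKl row_mxKr mxE eqxx; split => //; exists z.2.
by rewrite /w row_mxKl row_mxKr mxE eqxx chart_mapK.
Unshelve. all: by end_near. Qed.

Lemma smooth_flow_bounded0 (R : realType) (M : surface R) (p : R -> M -> R) :
  compact [set: M] -> smooth_flow p ->
  exists P : R, 0 < P /\ forall x, `|p 0 x| <= P.
Proof.
move=> cM /smooth_flow_continuous pc.
pose K : set (R * M) := [set 0] `*` [set: M].
have cK : compact K by apply: compact_setX => //; exact: compact_set1.
have sub : K `<=` [set z : R * M | 0 <= z.1] by move=> [s y] [/= -> _].
have := continuous_compact (continuous_subspaceW sub pc) cK.
move=> /compact_bounded [P [_ Pb]].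
exists (Num.max P 0 + 1); split.
  by rewrite ltr_wpDl// le_max lexx orbT.
move=> x; apply: Pb; last by exists (0, x).
by rewrite ltr_pwDr// le_max lexx.
Qed.

(** * The maximum principle *)

Lemma derive_ge0_at_left_max (R : realType) (g : R -> R) (t d : R) :
  0 < t -> is_derive t (1 : R) g d ->
  (forall s, 0 <= s <= t -> g s <= g t) -> 0 <= d.
Proof.
move=> t0 [dg dE] gmax; rewrite leNgt; apply/negP => d0.
have : (fun h : R => h^-1 *: ((g \o shift t) (h *: 1) - g t)) @ 0^' --> d.
  by rewrite -dE.
move=> /cvgr_lt /(_ _ d0) [e /= e0 He].
pose h := Num.min e t / 2.
have mpos : 0 < Num.min e t by rewrite lt_min e0.
have hpos : 0 < h by rewrite /h divr_gt0.
have /andP[he ht] : (h < e) && (h < t).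
  by rewrite -lt_min /h; lra.
have /= := He (- h); rewrite sub0r opprK gtr0_norm// => /(_ he).
rewrite oppr_eq0 gt_eqF// => /(_ isT); rewrite scaler1 /GRing.scale /=.
rewrite ltNge => /negP; apply; apply: mulr_le0.
  by rewrite invr_le0 oppr_le0 ltW.
by rewrite subr_le0; apply: gmax; apply/andP; split; lra.
Qed.

(** Subtracting eps t makes the inequality in time strict. If the maximum of
    v - eps t over [0, tau] x T is attained at a time t > 0, then comparison
    with earlier times gives dv >= eps there, while the spatial maximality gives
    dv <= 0; so it is attained at time 0. *)
Lemma parabolic_max_principle (R : realType) (T : topologicalType)
    (v dv : R -> T -> R) (B : R) :
  compact [set: T] ->
  {within [set z : R * T | 0 <= z.1], continuous (fun z => v z.1 z.2)} ->
  (forall (t : R) x, 0 < t -> is_derive t (1 : R) (fun s => v s x) (dv t x)) ->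
  (forall (t : R) x, 0 < t -> (forall y, v t y <= v t x) -> dv t x <= 0) ->
  (forall x, v 0 x <= B) ->
  forall (t : R) x, 0 <= t -> v t x <= B.
Proof.
move=> cT vcont vt dvmax v0 tau x0 tau0; apply/ler_addgt0Pr => e e0.
(* Small enough for the total correction eps * tau to stay below e. *)
pose eps := e / (tau + 1).
have eps0 : 0 < eps by rewrite divr_gt0// ltr_wpDl.
have epse : eps * tau <= e.
  rewrite /eps mulrAC ler_pdivrMr; last by rewrite ltr_wpDl.
  by rewrite ler_pM2l// lerDl.
pose K : set (R * T) := `[0, tau] `*` [set: T].
have cK : compact K by apply: compact_setX => //; exact: segment_compact.
pose w (z : R * T) := v z.1 z.2 - eps * z.1.
have wcont : {within K, continuous w}.
  have sub : K `<=` [set z : R * T | 0 <= z.1].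
    by move=> [s y] [/=]; rewrite in_itv /= => /andP[].
  have vK := continuous_subspaceW sub vcont.
  move=> z; apply: cvgB; first exact: vK.
  apply: cvgM; first exact: cvg_cst.
  have : continuous (fst : R * T -> R) by move=> u; exact: cvg_fst.
  by move/(@continuous_subspaceT _ _ K); apply.
have Kin s y : 0 <= s <= tau -> (s, y) \in K.
  by move=> sle; rewrite inE; split => //=; rewrite in_itv.
have [|[t y] tyK wmax] := compact_EVT_max _ cK wcont.
  by exists (tau, x0); apply: set_mem; rewrite Kin// tau0 lexx.
have /andP[t0 ttau] : 0 <= t <= tau.
  by move: tyK; rewrite inE => -[/=]; rewrite in_itv.
have := wmax (tau, x0) (Kin _ _ _); rewrite tau0 lexx => /(_ isT).
rewrite /w /= => wle.
move: t0; rewrite le_eqVlt => /orP[/eqP t0|t0].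
  move: wle; rewrite -t0 mulr0 subr0 => wle.
  by have := v0 y; lra.
have dle : dv t y <= 0.
  apply: dvmax => // y'; have := wmax (t, y') (Kin _ _ _).
  by rewrite (ltW t0) ttau /w /= lerD2r; exact.
have : 0 <= dv t y - eps.
  apply: (@derive_ge0_at_left_max R (fun s => v s y - eps * s) t) => //.
    have := vt t y t0 => d1.
    have d2 : is_derive t (1 : R) (fun s : R => eps * s) eps.
      by apply: is_derive_eq; rewrite scaler1.
    exact: is_deriveB.
  move=> s /andP[s0 st].
  apply: (wmax (s, y)); apply: Kin; rewrite s0 /=; exact: le_trans st ttau.
by lra.
Qed.

(** * The normalized Ricci flow *)

(** At positive times the restriction 0 <= t + s on the increment holds near 0,
    so the derivative is two-sided. *)
Lemma ricci_flow_is_derive (R : realType) (M : surface R) (h : metric M)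
    (p : R -> M -> R) (t : R) (x : M) :
  normalized_ricci_flow h p -> 0 < t ->
  is_derive t (1 : R) (fun s => p s x)
    (expR (- 2 * p t x) * (laplacian h (p t) x + 1) - 1).
Proof.
move=> flow t0; set d := (X in is_derive _ _ _ X).
have cv : (fun s : R => s^-1 *: (((fun s => p s x) \o shift t) (s *: 1) - p t x))
    @ 0^' --> d.
  have -> : (fun s : R => s^-1 *: (((fun s => p s x) \o shift t) (s *: 1) - p t x))
          = (fun s => s^-1 * (p (t + s) x - p t x)).
    by apply/funext => s /=; rewrite scaler1 (addrC s).
  apply: cvg_trans (flow t x (ltW t0)); apply: cvg_app => A wA.
  have pos : \forall s \near (0 : R)^', 0 <= t + s.
    near=> s; rewrite -lerBlDl sub0r lerNl.
    have : `|s| < t by near: s; apply: dnbhs0_lt.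
    by move/ltW; apply: le_trans; rewrite -normrN ler_norm.
  suff : \forall s \near (0 : R)^', A s by [].
  near=> s; have st : 0 <= t + s by near: s.
  by move: st; near: s; exact: wA.
by apply: DeriveDef; [apply/cvg_ex; exists d | exact: cvg_lim].
Unshelve. all: by end_near. Qed.

(** The deviation of the conformal factor e^{2p} from its limit 1, rescaled by
    the decay rate of the linearized flow. *)
Definition rescaled_defect (R : realType) (M : surface R) (p : R -> M -> R)
    (t : R) (x : M) : R :=
  (expR (2 * p t x) - 1) * expR (2 * t).

Lemma rescaled_defect_le (R : realType) (M : surface R) (p : R -> M -> R)
    (t : R) (x y : M) :
  (rescaled_defect p t x <= rescaled_defect p t y) = (p t x <= p t y).
Proof.
by rewrite /rescaled_defect ler_pM2r ?expR_gt0// lerD2r ler_expR ler_pM2l.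
Qed.

Lemma rescaled_defect_continuous (R : realType) (M : surface R)
    (p : R -> M -> R) :
  smooth_flow p ->
  {within [set z : R * M | 0 <= z.1],
    continuous (fun z => rescaled_defect p z.1 z.2)}.
Proof.
move=> /smooth_flow_continuous pc z; rewrite /rescaled_defect.
have ec : forall f : subspace [set z : R * M | 0 <= z.1] -> R,
    {for z, continuous f} -> {for z, continuous (fun y => expR (2 * f y))}.
  move=> f fc; apply: (@continuous_comp _ _ _ (fun y => 2 * f y) expR).
    by apply: cvgM; [exact: cvg_cst | exact: fc].
  exact: continuous_expR.
apply: cvgM.
  by apply: cvgB; [exact/ec/pc | exact: cvg_cst].
apply: ec.
have : continuous (fst : R * M -> R) by move=> u; exact: cvg_fst.
by move/(@continuous_subspaceT _ _ [set z : R * M | 0 <= z.1]); apply.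
Qed.

Lemma rescaled_defect_is_derive (R : realType) (M : surface R) (h : metric M)
    (p : R -> M -> R) (t : R) (x : M) :
  normalized_ricci_flow h p -> 0 < t ->
  is_derive t (1 : R) (fun s => rescaled_defect p s x)
    (2 * expR (2 * t) * laplacian h (p t) x).
Proof.
move=> flow t0; have dp := ricci_flow_is_derive x flow t0.
have exp2 : forall (f : R -> R) (df : R), is_derive t (1 : R) f df ->
    is_derive t (1 : R) (fun s => expR (2 * f s)) (expR (2 * f t) * (2 * df)).
  move=> f df fd; apply: (@is_derive1_comp R expR (fun s => 2 * f s)).
have d1 := exp2 _ _ dp.
have d2 := exp2 id 1 (is_derive_id _ _).
have d3 := is_deriveB d1 (is_derive_cst (1 : R) t (1 : R)).
have d4 := is_deriveM d3 d2.
apply: (is_derive_eq d4).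
rewrite !fctE /= /GRing.scale /=.
have -> : expR (- 2 * p t x) = (expR (2 * p t x))^-1 by rewrite mulNr expRN.
by field; rewrite gt_eqF// expR_gt0.
Qed.

(** Both estimates are 1 + x <= e^x, at x = 2q and x = -2q. The second one
    bounds -2q by e^{-2q} - 1 = e^{-2q} (1 - e^{2q}), where the factor e^{-2q}
    is at most e^{2P} because T >= 1; and e^{2P} (1 - e^{-2P}) = e^{2P} - 1. *)
Lemma norm_le_of_defect (R : realType) (P T q : R) :
  0 < P -> 1 <= T ->
  (expR (2 * q) - 1) * T <= expR (2 * P) - 1 ->
  (1 - expR (2 * q)) * T <= 1 - expR (- (2 * P)) ->
  `|q| <= (expR (2 * P) - 1) / 2 * T^-1.
Proof.
move=> P0 T1 up lo; have T0 : 0 < T by lra.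
have E0 : 0 < expR (2 * P) by exact: expR_gt0.
have e0 : 0 < expR (2 * q) by exact: expR_gt0.
set c := expR (2 * P) in up E0 *; set e := expR (2 * q) in up lo e0.
have cinv : expR (- (2 * P)) = c^-1 by rewrite expRN.
have c1 : 1 < c by rewrite /c expR_gt1; lra.
rewrite cinv in lo.
have qe : 1 + 2 * q <= e by exact: expR_ge1Dx.
have qN : 1 - 2 * q <= e^-1 by have := expR_ge1Dx (- (2 * q)); rewrite expRN.
have up' : e - 1 <= (c - 1) / T by rewrite ler_pdivlMr.
have ec : c^-1 <= e.
  have [e1|e1] := leP 1 e.
    by apply: le_trans e1; rewrite invf_le1 // ltW.
  have : (1 - e) * 1 <= (1 - e) * T by rewrite ler_pM2l; lra.
  by lra.
have lo' : e^-1 - 1 <= (c - 1) / T.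
  have [e1|e1] := leP 1 e.
    apply: (@le_trans _ _ 0); first by rewrite subr_le0 invf_le1.
    by rewrite divr_ge0; lra.
  have -> : e^-1 - 1 = e^-1 * (1 - e) by field; rewrite gt_eqF.
  rewrite ler_pdivlMr// -mulrA.
  have -> : c - 1 = c * (1 - c^-1) by field; rewrite gt_eqF.
  apply: ler_pM => //.
  - by rewrite invr_ge0 ltW.
  - by rewrite mulr_ge0; lra.
  - by rewrite invf_ple ?posrE.
have -> : (c - 1) / 2 * T^-1 = (c - 1) / T / 2 by ring.
by rewrite ler_norml; apply/andP; split; lra.
Qed.

Theorem corollary7 (R : realType) (M : surface R) (chi : int)
    (h g0 : metric M) (p0 : M -> R) (p : R -> M -> R) :
  compact [set: M] ->
  has_euler_characteristic R M chi -> chi < 0 ->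
  (forall x : M, gauss_curvature h x = -1) ->
  conformal_to g0 h p0 ->
  area g0 = area h ->
  smooth_flow p ->
  normalized_ricci_flow h p ->
  p 0 = p0 ->
  exists c C : R, 0 < c /\ 0 < C /\
    forall t : R, 0 <= t ->
      (ereal_sup [set `|p t x|%:E | x in [set: M]] <=
        (c * expR (- C * t))%:E)%E.
Proof.
move=> cM _ _ _ _ _ sp flow _.
have [P [P0 pP]] := smooth_flow_bounded0 cM sp.
have vc := rescaled_defect_continuous sp.
have dv t x : 0 < t -> _ := rescaled_defect_is_derive x flow.
have factor t : 0 < 2 * expR (2 * t) :> R by rewrite mulr_gt0 ?expR_gt0.
have upper := parabolic_max_principle (B := expR (2 * P) - 1) cM vc dv.
have lower := @parabolic_max_principle R M (fun t x => - rescaled_defect p t x)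
  (fun t x => - (2 * expR (2 * t) * laplacian h (p t) x))
  (1 - expR (- (2 * P))) cM.
exists ((expR (2 * P) - 1) / 2), 2; split; [|split => //].
  by rewrite divr_gt0// subr_gt0 expR_gt1 mulr_gt0.
move=> t t0; apply: ge_ereal_sup => _ [x _ <-]; rewrite lee_fin.
rewrite mulNr expRN; apply: norm_le_of_defect => //.
- by rewrite -expR0 ler_expR mulr_ge0.
- apply: upper => // [s y s0 ymax|y].
    rewrite pmulr_rle0//; apply: laplacian_le0_at_max => [|z].
      exact: smooth_flow_slice sp (ltW s0).
    by rewrite -(rescaled_defect_le p s).
  rewrite /rescaled_defect mulr0 expR0 mulr1 lerD2r// ler_expR ler_pM2l//.
  by have := pP y; rewrite ler_norml => /andP[].
- have -> : (1 - expR (2 * p t x)) * expR (2 * t) = - rescaled_defect p t x.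
    by rewrite /rescaled_defect -mulNr opprB.
  apply: (lower _ _ _ _ t x t0).
  + by move=> z; apply: cvgN; exact: vc.
  + by move=> s y s0; apply: is_deriveN; exact: dv.
  + move=> s y s0 ymin; rewrite oppr_le0 mulr_ge0 ?(ltW (factor _))//.
    apply: laplacian_ge0_at_min => [|z].
      exact: smooth_flow_slice sp (ltW s0).
    by rewrite -(rescaled_defect_le p s) -lerN2.
  + move=> y; rewrite /rescaled_defect mulr0 expR0 mulr1 opprB lerB//.
    rewrite ler_expR -mulrN ler_pM2l//.
    by have := pP y; rewrite ler_norml => /andP[].
Qed.
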